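(* For every tree presentation $T$, the automorphism group $\mathrm{Aut}(\mathcal{L}^*_T)$ (with the topology of pointwise convergence) is extremely amenable.
   Context: Tree presentations are finite trees whose nodes are finite sequences of positive integers, each node labelled $\ell$ (leaf), $s$ (sum) or $\sigma$ (shuffle), defined inductively: $1$ is the tree consisting only of the root $\langle\rangle$, labelled $\ell$; if $T_1,\dots,T_k$ ($k\ge1$) are tree presentations then $s(T_1,\dots,T_k)$ (resp. $\sigma(T_1,\dots,T_k)$) is the tree whose nodes are the root $\langle\rangle$, labelled $s$ (resp. $\sigma$), together with the nodes $\langle i\rangle^\frown t$ for $1\le i\le k$ and $t\in T_i$, labelled as $t$ is in $T_i$. For a sequence $u$ and $i\le|u|$, $u\upharpoonright i$ is its initial segment of length $i$. Fix once and for all a partition $\langle\mathbb{Q}_n\rangle_{n\ge1}$ of $\mathbb{Q}$ into sets each dense in $\mathbb{Q}$, with $n\in\mathbb{Q}_n$. For $q\in\mathbb{Q}$ let $\#(q)$ be the $n$ with $q\in\mathbb{Q}_n$; for $\bar r=\langle r_0,\dots,r_{m-1}\rangle$ let $\#(\bar r)=\langle\#(r_0),\dots,\#(r_{m-1})\rangle$. $\mathcal{L}_T$ is the set of finite sequences $\bar r$ of rationals such that $\#(\bar r)$ is a leaf of $T$ and for each $i<|\bar r|$, if $\#(\bar r)\upharpoonright i$ is a sum node then $r_i=\#(r_i)$, ordered lexicographically. For a node $t$, $D_t$ is the set of $\bar r\in\mathcal{L}_T$ such that $\#(\bar r)$ extends $t$. $\mathcal{L}^*_T$ is the expansion of $(\mathcal{L}_T,<)$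 by binary relations $E_t$ ($t\in T$), where $\bar r\,E_t\,\bar s$ iff $\bar r,\bar s\in D_t$ and $\bar r\upharpoonright|t|=\bar s\upharpoonright|t|$. A topological group is extremely amenable if every continuous action of it on a compact Hausdorff space has a fixed point. *)

(* Defs.v *)
From HB Require Import structures.
From mathcomp Require Import all_boot all_order all_algebra.
From mathcomp Require Import all_classical all_reals all_analysis.

Set Implicit Arguments.
Unset Strict Implicit.
Unset Printing Implicit Defensive.

Import Order.TTheory GRing.Theory Num.Theory.

Local Open Scope classical_set_scope.

HB.mixin Record isTopologicalGroup G of Group G & Topological G := {
  mulg_continuous : continuous (fun p : G * G => (p.1 * p.2)%g);
  invg_continuous : continuous (fun g : G => g^-1%g)
}.

#[short(type="topologicalGroupType")]
HB.structure Definition TopologicalGroup :=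
  {G of Group G & Topological G & isTopologicalGroup G}.

(* Compact spaces acted upon are nonempty, as usual in topological dynamics:
   otherwise no group at all would be extremely amenable. *)
Definition extremely_amenable (G : topologicalGroupType) : Prop :=
  forall (X : topologicalType) (act : G -> X -> X),
    [set: X] !=set0 -> compact [set: X] -> hausdorff_space X ->
    (forall x, act 1%g x = x) ->
    (forall g h x, act (g * h)%g x = act g (act h x)) ->
    continuous (fun p : G * X => act p.1 p.2) ->
    exists x, forall g, act g x = x.

Section Automorphisms.
Variables (X : choiceType) (I : Type) (R : I -> rel X).

Record automorphism : Type := Automorphism {
  aut_fun :> X -> X;
  aut_bij : bijective aut_fun;
  aut_rel : forall i x y, R i (aut_fun x) (aut_fun y) = R i x y
}.

HB.instance Definition _ := gen_eqMixin automorphism.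
HB.instance Definition _ := gen_choiceMixin automorphism.

Lemma aut_ext (f g : automorphism) : f =1 g -> f = g.
Proof.
case: f g => [f fb fr] [g gb gr] /= fg.
have e : f = g by apply/funext.
by move: fb fr; rewrite e => fb fr; congr Automorphism; exact: Prop_irrelevance.
Qed.

Definition aut_one : automorphism :=
  @Automorphism id (Bijective (fun _ => erefl) (fun _ => erefl))
    (fun _ _ _ => erefl).

Lemma aut_mul_rel (f g : automorphism) i x y :
  R i ((f \o g) x) ((f \o g) y) = R i x y.
Proof. by rewrite /= !aut_rel. Qed.

Definition aut_mul (f g : automorphism) : automorphism :=
  Automorphism (bij_comp (aut_bij f) (aut_bij g)) (aut_mul_rel f g).

Lemma aut_inv_ex (f : automorphism) :
  exists g : automorphism, cancel f g /\ cancel g f.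
Proof.
have [g fg gf] := aut_bij f.
have gr i x y : R i (g x) (g y) = R i x y by rewrite -(aut_rel f) !gf.
by exists (Automorphism (Bijective gf fg) gr).
Qed.

Definition aut_inv (f : automorphism) : automorphism :=
  projT1 (cid (aut_inv_ex f)).

Lemma autK (f : automorphism) : cancel f (aut_inv f).
Proof. by rewrite /aut_inv; case: cid => ? []. Qed.

Lemma autVK (f : automorphism) : cancel (aut_inv f) f.
Proof. by rewrite /aut_inv; case: cid => ? []. Qed.

Let aut_mulA : associative aut_mul.
Proof. by move=> f g h; exact: aut_ext. Qed.

Let aut_mul1 : left_id aut_one aut_mul.
Proof. by move=> f; exact: aut_ext. Qed.

Let aut_mulr1 : right_id aut_one aut_mul.
Proof. by move=> f; exact: aut_ext. Qed.

Let aut_mulV : left_inverse aut_one aut_inv aut_mul.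
Proof. by move=> f; apply: aut_ext => x /=; rewrite autK. Qed.

Let aut_mulrV : right_inverse aut_one aut_inv aut_mul.
Proof. by move=> f; apply: aut_ext => x /=; rewrite autVK. Qed.

HB.instance Definition _ :=
  isGroup.Build automorphism aut_mulA aut_mul1 aut_mulr1 aut_mulV aut_mulrV.

(* Pointwise convergence: the topology induced from the product of discrete
   copies of [X]. *)
Definition aut_ptws (f : automorphism) : {ptws X -> discrete_topology X} := f.

HB.instance Definition _ :=
  Topological.copy automorphism (initial_topology aut_ptws).

Lemma aut_eval_nbhs (f : automorphism) (x : X) :
  nbhs f [set g : automorphism | g x = f x].
Proof.
have cf : {for f, continuous (aut_ptws : automorphism -> _)}.
  exact: (@initial_continuous automorphism _ aut_ptws).
have ce := @proj_continuous X (fun=> discrete_topology X) x (aut_ptws f).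
apply: (cf [set h : {ptws X -> discrete_topology X} | h x = f x]).
exact: (ce _ (@discrete_set1 (discrete_topology X) (f x))).
Qed.

Lemma cvg_aut (F : set_system automorphism) (f : automorphism) : Filter F ->
  (forall x, F [set g : automorphism | g x = f x]) -> F --> f.
Proof.
move=> FF Ff.
have cv : aut_ptws @ F --> aut_ptws f.
  apply/(@pointwise_cvgP (discrete_topology X) (discrete_topology X)) => x.
  by apply/discrete_cvg; exact: Ff.
move=> A; rewrite nbhsE => -[_ [[C oC <-] Cf] sCA].
apply: filterS sCA _; apply: cv.
by apply: open_nbhs_nbhs; split.
Qed.

Let aut_mul_continuous :
  continuous (fun p : automorphism * automorphism => (p.1 * p.2)%g).
Proof.
move=> [f g]; apply: cvg_aut => x.
exists ([set h : automorphism | h (g x) = f (g x)],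
        [set h : automorphism | h x = g x]).
  by split; exact: aut_eval_nbhs.
by move=> [h k] /= [hE kE]; rewrite /= kE hE.
Qed.

Let aut_inv_continuous : continuous (fun f : automorphism => f^-1%g).
Proof.
move=> f; apply: (@cvg_aut _ _ (fmap_filter _ (nbhs_filter f))) => x.
apply: (@filterS _ _ (nbhs_filter f)) (aut_eval_nbhs f (aut_inv f x)) => g /= gE.
by apply: (can_inj (autK g)); rewrite autVK gE autVK.
Qed.

HB.instance Definition _ :=
  isTopologicalGroup.Build automorphism aut_mul_continuous aut_inv_continuous.

End Automorphisms.

(* [tree_sum T Ts] is s(T, Ts) and [tree_shuffle T Ts] is sigma(T, Ts): keeping
   the first subtree apart makes the sequence of subtrees nonempty. *)
Inductive tree_presentation : Type :=
| tree_one
| tree_sum of tree_presentation & seq tree_presentation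
| tree_shuffle of tree_presentation & seq tree_presentation.

Variant node_label : Type := leaf_label | sum_label | shuffle_label.

Definition root_label (T : tree_presentation) : node_label :=
  match T with
  | tree_one => leaf_label
  | tree_sum _ _ => sum_label
  | tree_shuffle _ _ => shuffle_label
  end.

Definition subtrees (T : tree_presentation) : seq tree_presentation :=
  match T with
  | tree_one => [::]
  | tree_sum T1 Ts => T1 :: Ts
  | tree_shuffle T1 Ts => T1 :: Ts
  end.

(* The label of [t] in [T], or [None] if [t] is not a node of [T]; subtrees are
   numbered from 1. *)
Fixpoint label_at (T : tree_presentation) (t : seq nat) : option node_label :=
  match t with
  | [::] => Some (root_label T)
  | 0%N :: _ => None
  | i.+1 :: t' => if onth (subtrees T) i is Some T' then label_at T' t' else None
  end.

Definition is_node T t : bool := isSome (label_at T t).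
Definition is_leaf T t : bool := if label_at T t is Some leaf_label then true else false.
Definition is_sum T t : bool := if label_at T t is Some sum_label then true else false.

(* A partition of Q into dense sets Q_n (n >= 1) with n in Q_n, given by the map
   # sending q to the index of its class. *)
Record dense_partition (num : rat -> nat) : Prop := DensePartition {
  num_gt0 : forall q, (0 < num q)%N;
  num_nat : forall n, (0 < n)%N -> num n%:R%R = n;
  num_dense : forall n, (0 < n)%N -> forall a b : rat, (a < b)%R ->
    exists q, [/\ (a < q)%R, (q < b)%R & num q = n]
}.

Section LT.
Variables (num : rat -> nat) (T : tree_presentation).

Definition in_L (r : seq rat) : bool :=
  is_leaf T (map num r) &&
  [forall i : 'I_(size r),
     is_sum T (take i (map num r)) ==> (r`_i == (num r`_i)%:R)%R].

Definition L : Type := {r : seq rat | in_L r}.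
HB.instance Definition _ := Countable.on L.

Definition L_lt (r s : L) : bool := (val r < val s :> seqlexi rat)%O.

Definition in_D (t : seq nat) (r : L) : bool := prefix t (map num (val r)).

Definition L_E (t : seq nat) (r s : L) : bool :=
  [&& in_D t r, in_D t s & take (size t) (val r) == take (size t) (val s)].

(* The language of L*_T: the symbol < and one symbol E_t for each node t. *)
Variant L_symbol : Type :=
| symbol_lt
| symbol_E (t : seq nat) of is_node T t.

Definition L_star (a : L_symbol) : rel L :=
  match a with
  | symbol_lt => L_lt
  | @symbol_E t _ => L_E t
  end.

End LT.

(* Main.v *)
Require Import Defs.
From mathcomp Require Import all_boot all_order all_algebra.
From mathcomp Require Import all_classical all_reals all_analysis.

(* By induction on [T].  If [T] is not a leaf, an element of L_T is a head [q]
   followed by an element of the order of a subtree, so Aut(L*_T) is the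
   extension of the automorphism group of the coloured chain of heads by the
   product, over all heads, of the groups of the subtrees.  Groups with the
   fixed point property are closed under commuting families, closures and such
   extensions: the fixed points of the normal subgroup form a nonempty closed
   invariant set, on which the group of the chain acts.  For a sum the chain is
   rigid.  For a shuffle it is a dense order in which every colour is dense; by
   back-and-forth it is homogeneous, and Ramsey's theorem gives the Ramsey
   property of its finite suborders, hence a fixed point by the argument of
   Kechris, Pestov and Todorcevic. *)

Set Implicit Arguments.
Unset Strict Implicit.
Unset Printing Implicit Defensive.

Import Order.TTheory GRing.Theory Num.Theory.

Local Open Scope classical_set_scope.

(** * Ramsey's theorem for infinite sequences *)

Definition increasing (h : nat -> nat) := {homo h : m n / (m < n)%N}.

Lemma increasingE h : increasing h -> {mono h : m n / (m < n)%N}.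
Proof. by move=> hi m n; apply: (leqW_mono (leq_mono hi)). Qed.

Lemma increasing_comp f g : increasing f -> increasing g -> increasing (f \o g).
Proof. by move=> fi gi m n /gi /fi. Qed.

Lemma map_preim (A B : Type) (e : A -> B) (Q : pred B) (s : seq B) :
  (forall x, Q x -> exists y, e y = x) -> all Q s -> exists s', map e s' = s.
Proof.
move=> eQ; elim: s => [_|x s IH /= /andP[/eQ[y <-] /IH[s' <-]]]; first by exists [::].
by exists (y :: s').
Qed.

(** Some value recurs beyond every bound, and its successive occurrences form the subsequence. *)
Lemma infinite_pigeonhole (C : finType) (u : nat -> C) :
  exists (k : C) (h : nat -> nat), increasing h /\ forall i, u (h i) = k.
Proof.
have [k ki] : exists k, forall m, exists n, (m < n)%N /\ u n = k.
  apply: contrapT => /forallNP none.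
  have bnd k : exists m, forall n, (m < n)%N -> u n <> k.
    have /existsNP[m mk] := none k; exists m => n mn un; apply: mk.
    by exists n.
  have [b bP] := choice bnd.
  by apply: (bP (u (\max_k b k).+1) (\max_k b k).+1) => //; rewrite ltnS leq_bigmax.
have [nx nxP] := choice ki.
(* The exponent is [i.+1] because index 0 itself need not have colour [k]. *)
exists k, (fun i => iter i.+1 nx 0%N); split; last by move=> i; case: (nxP (iter i nx 0%N)).
by apply: (homo_ltn ltn_trans) => i /=; case: (nxP (nx (iter i nx 0%N))).
Qed.

(** Induction on [n]: nested thinnings make the colour of a tuple depend on its first entry alone,
    and the pigeonhole principle then makes it constant. *)
Lemma infinite_ramsey (C : finType) (n : nat) (c : seq nat -> C) :
  exists (h : nat -> nat) (k : C), increasing h /\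
    forall js, sorted ltn js -> size js = n -> c (map h js) = k.
Proof.
elim: n c => [|n IH] c.
  by exists id, (c [::]); split=> // js _ /size0nil ->.
(* The term [e 0] is kept and the later terms are thinned by [dk.1], which skips index 0, until all
   tuples starting with [e 0] have one colour. *)
have step (e : nat -> nat) : exists dk : (nat -> nat) * C,
    [/\ increasing dk.1, (0 < dk.1 0)%N &
     forall js, sorted ltn js -> size js = n ->
       c (e 0%N :: map (e \o dk.1) js) = dk.2].
  have [h [k [hi hk]]] := IH (fun js => c (e 0%N :: map (e \o S) js)).
  exists (S \o h, k); split=> //= js js_s js_n.
  by rewrite -(hk js js_s js_n) -map_comp.
have [F FP] := choice step.
pose e := fix e i := if i is i'.+1 then e i' \o (F (e i')).1 else id.
have eS i : e i.+1 = e i \o (F (e i)).1 by [].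
have e_inc i : increasing (e i).
  by elim: i => [|i IHi] //; rewrite eS; apply: increasing_comp => //; case: (FP (e i)).
have e_ran i j : (i <= j)%N -> forall x, exists y, e i y = e j x.
  elim: j => [|j IHj]; first by rewrite leqn0 => /eqP-> x; exists x.
  rewrite leq_eqVlt => /predU1P[->|ij] x; first by exists x.
  by rewrite eS /=; exact: IHj.
pose a i := e i 0%N.
have a_inc : increasing a.
  apply: (homo_ltn ltn_trans) => i.
  by rewrite /a eS /= increasingE //; case: (FP (e i)).
have [k [h [h_inc hk]]] := infinite_pigeonhole (fun i => (F (e i)).2).
exists (a \o h), k; split; first exact: increasing_comp.
move=> [//|j js] /= js_s [js_n].
have js_gt : all (ltn j) js by apply: order_path_min js_s; exact: ltn_trans.
(* The entries after the first are all terms of the thinned sequence [e (h j).+1], so they can be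
   pulled back along it. *)
have [js' js'E] : exists js', map (e (h j).+1) js' = map (a \o h) js.
  apply: (@map_preim _ _ _ (fun x => `[< exists y, e (h j).+1 y = x >])).
    by move=> x /asboolP.
  rewrite all_map; apply: sub_all js_gt => i /= /h_inc ji; apply/asboolP.
  exact: e_ran ji 0%N.
have js'_n : size js' = n by rewrite -js_n -(size_map (a \o h) js) -js'E size_map.
have js'_s : sorted ltn js'.
  rewrite -(mono_sorted (increasingE (e_inc (h j).+1))) js'E.
  by apply: homo_sorted (path_sorted js_s); exact: increasing_comp.
have [_ _ /(_ js' js'_s js'_n)] := FP (e (h j)).
by rewrite hk => <-; rewrite -js'E.
Qed.

(** * Back-and-forth on the coloured rationals *)

Section BackAndForth.
Variables (num : rat -> nat).
Hypothesis num_part : dense_partition num.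
Local Open Scope ring_scope.

(** A bound [a] of [lo] strictly below [hi] leaves room for some [b] above [a] that still bounds
    [hi] from below; density applies between them, even when a list is empty. *)
Lemma num_between (n : nat) (lo hi : seq rat) : (0 < n)%N ->
  (forall x y, x \in lo -> y \in hi -> x < y) ->
  exists q, [/\ forall x, x \in lo -> x < q, forall y, y \in hi -> q < y & num q = n].
Proof.
move=> n0 lohi.
have [a [loa ahi]] : exists a, (forall x, x \in lo -> x <= a) /\ (forall y, y \in hi -> a < y).
  elim: lo lohi => [_|x lo IH lohi].
    elim: hi => [|y hi [a [_ ahi]]]; first by exists 0.
    exists (Num.min a (y - 1)); split=> // z; rewrite inE gt_min => /predU1P[->|/ahi->//].
    by rewrite ltrBlDr ltrDl ltr01 orbT.
  have [u v ulo vhi|a [loa ahi]] := IH; first by apply: lohi; rewrite // inE ulo orbT.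
  exists (Num.max x a); split=> [z|z zhi].
    by rewrite inE le_max => /predU1P[->|/loa->]; rewrite ?lexx ?orbT.
  by rewrite gt_max ahi // lohi // mem_head.
have [b [ab bhi]] : exists b, a < b /\ (forall y, y \in hi -> b <= y).
  elim: hi {lohi} ahi => [_|y hi IH ahi]; first by exists (a + 1); rewrite ltrDl ltr01.
  have [z zhi|b [ab bhi]] := IH; first by apply: ahi; rewrite inE zhi orbT.
  exists (Num.min y b); split; first by rewrite lt_min ab ahi // mem_head.
  by move=> z; rewrite inE ge_min => /predU1P[->|/bhi->]; rewrite ?lexx ?orbT.
have [q [aq qb nq]] := num_dense num_part n0 ab.
exists q; split=> // [x /loa xa|y /bhi by_]; first exact: le_lt_trans xa aq.
exact: lt_le_trans qb by_.
Qed.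

(** The order condition, used in both directions, makes [p] the graph of an injective function. *)
Definition partial_iso (p : seq (rat * rat)) : Prop :=
  (forall u, u \in p -> num u.1 = num u.2) /\
  (forall u v, u \in p -> v \in p -> (u.1 < v.1) = (u.2 < v.2)).

Definition swap (p : seq (rat * rat)) := [seq (u.2, u.1) | u <- p].

Lemma mem_swap p x y : ((x, y) \in swap p) = ((y, x) \in p).
Proof.
apply/mapP/idP => [[[a b] abp /= [-> ->]] //|yxp].
by exists (y, x).
Qed.

Lemma partial_iso_swap p : partial_iso p -> partial_iso (swap p).
Proof.
move=> [pn pl]; split=> [u /mapP[v vp ->] /=|u v /mapP[u' up ->] /mapP[v' vp ->] /=].
  by rewrite pn.
by rewrite pl.
Qed.

(** The forth step: the image is placed between the images of the points below and above [x].
    Applied to [swap p] it is the back step. *)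
Lemma partial_iso_add p x : partial_iso p ->
  exists p', [/\ partial_iso p', {subset p <= p'} & exists y, (x, y) \in p'].
Proof.
move=> [pn pl].
have [/mapP[[x' y] xyp /= ->]|xNp] := boolP (x \in map fst p).
  by exists p; split=> //; exists y.
have [|y [loy yhi ny]] :=
  @num_between (num x) [seq u.2 | u <- p & u.1 < x] [seq u.2 | u <- p & x < u.1] (num_gt0 num_part x).
  move=> _ _ /mapP[u + ->] /mapP[v + ->]; rewrite !mem_filter => /andP[ux up] /andP[xv vp].
  by rewrite -pl //; exact: lt_trans ux xv.
have side u : u \in p -> ((u.1 < x) = (u.2 < y)) /\ ((x < u.1) = (y < u.2)).
  move=> up; have : u.1 != x by apply: contra xNp => /eqP <-; apply: map_f.
  case: ltgtP => // xu _.
    have uy : u.2 < y by apply: loy; apply: map_f; rewrite mem_filter xu.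
    by rewrite uy; split=> //; apply/esym/negbTE; rewrite -leNgt ltW.
  have yu : y < u.2 by apply: yhi; apply: map_f; rewrite mem_filter xu.
  by rewrite yu; split=> //; apply/esym/negbTE; rewrite -leNgt ltW.
exists ((x, y) :: p); split.
- split=> [u|u v]; first by rewrite inE => /predU1P[->|/pn].
  rewrite !inE => /predU1P[->|up] /predU1P[->|vp] /=; rewrite ?ltxx //; last exact: pl.
    by case: (side _ vp).
  by case: (side _ up).
- by move=> u up; rewrite inE up orbT.
- by exists y; rewrite mem_head.
Qed.

Lemma partial_iso_extend p : partial_iso p ->
  exists f g : rat -> rat, [/\ cancel f g, cancel g f,
    {mono f : x y / x < y}, forall x, num (f x) = num x & forall u, u \in p -> f u.1 = u.2].
Proof.
move=> p_iso.
have step (px : {p | partial_iso p} * rat) : exists p' : {p | partial_iso p},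
    [/\ {subset sval px.1 <= sval p'}, exists y, (px.2, y) \in sval p' &
        exists y, (y, px.2) \in sval p'].
  case: px => [[q q_iso] x] /=.
  have [q1 [q1_iso qq1 [y xy]]] := partial_iso_add x q_iso.
  have [q2 [q2_iso q1q2 [z xz]]] := partial_iso_add x (partial_iso_swap q1_iso).
  exists (exist _ (swap q2) (partial_iso_swap q2_iso)) => /=.
  have sub1 : {subset q1 <= swap q2}.
    by move=> [a b] abq; rewrite mem_swap q1q2 // mem_swap.
  by split=> [u /qq1 /sub1//||]; [exists y; exact: sub1|exists z; rewrite mem_swap].
have [F FP] := choice step.
(* Stage [i'.+1] adds the rational with code [i'], or 0 if there is none, so every rational enters
   both domain and range. *)
pose P := fix P i := if i is i'.+1 then F (P i', odflt 0 (unpickle i')) else exist _ p p_iso.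
have PS i : {subset sval (P i) <= sval (P i.+1)} by case: (FP (P i, odflt 0 (unpickle i))).
have Pmono i j : (i <= j)%N -> {subset sval (P i) <= sval (P j)}.
  elim: j => [|j IHj]; first by rewrite leqn0 => /eqP->.
  by rewrite leq_eqVlt => /predU1P[->//|/IHj sub] u /sub /PS.
pose graph x y := exists i, (x, y) \in sval (P i).
have graph_lt x y x' y' : graph x y -> graph x' y' -> (x < x') = (y < y').
  move=> [i xyi] [j xyj]; have [_ pl] := svalP (P (maxn i j)).
  by apply: (pl (x, y) (x', y')); [apply: Pmono xyi|apply: Pmono xyj]; rewrite ?leq_maxl ?leq_maxr.
have graph_num x y : graph x y -> num y = num x.
  by move=> [i xyi]; have [pn _] := svalP (P i); rewrite -(pn _ xyi).
have graph_l x : exists y, graph x y.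
  have [_ [y xy] _] := FP (P (pickle x), odflt 0 (unpickle (pickle x))).
  by exists y, (pickle x).+1 => /=; rewrite pickleK /= in xy *.
have graph_r x : exists y, graph y x.
  have [_ _ [y xy]] := FP (P (pickle x), odflt 0 (unpickle (pickle x))).
  by exists y, (pickle x).+1 => /=; rewrite pickleK /= in xy *.
have graph_eq x y x' y' : graph x y -> graph x' y' -> (x = x' <-> y = y').
  move=> xy xy'; have E : (x == x') = (y == y').
    by rewrite !eq_le !leNgt (graph_lt _ _ _ _ xy xy') (graph_lt _ _ _ _ xy' xy).
  by split=> /eqP; rewrite ?E => /eqP // /eqP; rewrite -E => /eqP.
have [f fP] := choice graph_l; have [g gP] := choice graph_r.
exists f, g; split=> [x|x|x y|x|[x y] xyp /=].
- exact/(graph_eq _ _ _ _ (gP (f x)) (fP x)).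
- exact/(graph_eq _ _ _ _ (fP (g x)) (gP x)).
- by rewrite -(graph_lt _ _ _ _ (fP x) (fP y)).
- exact: graph_num.
- by apply/(graph_eq _ _ _ _ (fP x) (_ : graph x y)) => //; exists 0%N.
Qed.
End BackAndForth.

(** * Coloured chains: homogeneity and the Ramsey property *)

(** Structures have binary relations only, so colour [n] is encoded as a relation on the first
    argument; [None] stands for the order. *)
Definition chain_rel (num : rat -> nat) (P : pred rat) (a : option nat) :
    rel {q : rat | P q} :=
  fun x y => if a is Some n then num (val x) == n else (val x < val y)%R.

Section Chain.
Variables (num : rat -> nat) (P : pred rat).
Local Notation M := {q : rat | P q}.
Local Notation G := (automorphism (@chain_rel num P)).

Lemma chain_aut_lt (g : G) (x y : M) : (val (g x) < val (g y))%R = (val x < val y)%R.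
Proof. exact: (aut_rel g None). Qed.

Lemma chain_aut_num (g : G) (x : M) : num (val (g x)) = num (val x).
Proof. by have := aut_rel g (Some (num (val x))) x x; rewrite /= eqxx => /eqP. Qed.

Hypothesis num_part : dense_partition num.
Hypothesis P_num : forall q q', num q = num q' -> P q = P q'.

(** Homogeneity: membership in [P] depends only on the colour, so a colour-preserving automorphism
    of the rationals restricts to the chain. *)
Lemma chain_aut_extend (B : seq rat) (e : rat -> rat) :
  (forall b, b \in B -> num (e b) = num b) ->
  {in B &, {homo e : x y / (x < y)%R}} ->
  exists g : G, forall x : M, val x \in B -> val (g x) = e (val x).
Proof.
move=> e_num e_lt.
have e_mono := leW_mono_in (le_mono_in e_lt).
have [|f [f' [fK f'K f_lt f_num fE]]] := @partial_iso_extend num num_part [seq (b, e b) | b <- B].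
  split=> [_ /mapP[b bB ->]|_ _ /mapP[b bB ->] /mapP[b' b'B ->]] /=; first by rewrite e_num.
  by rewrite e_mono.
have fP (x : M) : P (f (val x)) by rewrite (P_num (f_num _)) (valP x).
have f'P (x : M) : P (f' (val x)) by rewrite -(P_num (f_num _)) f'K (valP x).
pose h (x : M) : M := Sub (f (val x)) (fP x).
have h_bij : bijective h.
  by exists (fun x : M => Sub (f' (val x)) (f'P x)) => x; apply: val_inj; rewrite /= ?fK ?f'K.
have h_rel a x y : chain_rel num a (h x) (h y) = chain_rel num a x y.
  by case: a => [n|]; rewrite /= ?f_num ?f_lt.
exists (Automorphism h_bij h_rel) => x xB /=.
by apply: (fE (_, _)); exact: (map_f (fun b => (b, e b))).
Qed.

(* The order is cut into the unit intervals [i, i + 1], each of which contains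
   every colour.  A colouring of the copies of [A] thus induces one of the
   sets of indices of intervals, to which Ramsey's theorem applies: the points
   of [A] go into distinct intervals, each to the point of its own colour. *)
Lemma chain_ramsey_sorted (C : finType) (c : seq rat -> C) (A : seq M) (F : seq G) :
  sorted <%R (map val A) ->
  exists (g : G) (k : C), forall f, f \in F -> c [seq val (g (f a)) | a <- A] = k.
Proof.
move=> A_s.
have /choice[pt ptP] (u : nat * nat) : exists q : rat, (0 < u.2)%N ->
    [/\ u.1%:R < q, q < u.1.+1%:R & num q = u.2]%R.
  case: (posnP u.2) => [->|u0]; first by exists 0%R.
  have [|q qP] := num_dense num_part u0 (_ : u.1%:R < u.1.+1%:R)%R; first by rewrite ltr_nat.
  by exists q.
(* [B] lists the points of all the copies of [A] by the elements of [F]. *)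
pose B : seq rat := sort <=%R (undup (flatten [seq [seq val (f a) | a <- A] | f : G <- F])).
have B_s : sorted <=%R B by exact: sort_le_sorted.
have mem_B f a : f \in F -> a \in A -> val (f a) \in B.
  move=> fF aA; rewrite mem_sort mem_undup; apply/flattenP.
  by exists [seq val (f a) | a <- A]; [exact: map_f|exact: (map_f (fun a => val (f a)))].
have index_lt : {in B &, {homo index^~ B : x y / (x < y)%R >-> (x < y)%N}}.
  move=> x y xB yB; apply: contraLR; rewrite -leqNgt -leNgt => yx.
  by apply: (sorted_leq_index le_trans lexx B_s).
have pt_lt i j a b : (i < j)%N -> (pt (i, num a) < pt (j, num b))%R.
  move=> ij; have [_ lt1 _] := ptP (i, num a) (num_gt0 num_part a).
  have [lt2 _ _] := ptP (j, num b) (num_gt0 num_part b).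
  by apply: lt_trans lt1 (le_lt_trans _ lt2); rewrite ler_nat.
pose chi (s : seq nat) := c [seq pt (u.1, num (val u.2)) | u <- zip s A].
have [h [k [h_inc hk]]] := infinite_ramsey (size A) chi.
(* The point of rank [m] in [B] goes to the point of its colour in interval number [h m]. *)
have [||g gE] := @chain_aut_extend B (fun b => pt (h (index b B), num b)).
- by move=> b _; have [_ _ ->] := ptP (h (index b B), num b) (num_gt0 num_part b).
- by move=> x y xB yB xy; apply/pt_lt/h_inc; exact: index_lt.
exists g, k => f fF.
rewrite -(hk [seq index (val (f a)) B | a <- A]) ?size_map //; last first.
  apply: (@homo_sorted_in _ _ (fun a => a \in A) _ (fun a b : M => val a < val b)%R); last 2 first.
  - exact/allP.
  - by rewrite sorted_map in A_s.
  by move=> x y xA yA xy; apply: index_lt; rewrite ?mem_B ?chain_aut_lt.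
rewrite /chi -map_comp -[A in zip _ A]map_id zip_map -map_comp.
congr c; apply/eq_in_map => a aA /=.
by rewrite gE ?mem_B // chain_aut_num.
Qed.

(** A copy of [A] is read off the copy of its increasing enumeration [A1] by ranks, so a colouring
    of the former induces one of the latter. *)
Lemma chain_ramsey (C : finType) (c : seq M -> C) (A : seq M) (F : seq G) :
  exists (g : G) (k : C), forall f, f \in F -> c [seq (g * f)%g a | a <- A] = k.
Proof.
case: A => [|a0 A']; first by exists 1%g, (c [::]).
set A := a0 :: A'.
pose A1 : seq M := pmap insub (sort <=%R (map val (undup A))).
have A1E : map val A1 = sort <=%R (map val (undup A)).
  rewrite pmap_filter; last exact: insubK.
  apply/all_filterP/allP => q; rewrite mem_sort => /mapP[x _ ->].
  by rewrite valK.
have memA1 x : (x \in A1) = (x \in A).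
  by rewrite -(mem_map val_inj) A1E mem_sort (mem_map val_inj) mem_undup.
pose c1 (s : seq rat) := c [seq nth a0 (pmap insub s) (index a A1) | a <- A].
have [|g [k gk]] := @chain_ramsey_sorted C c1 A1 F.
  by rewrite A1E sort_lt_sorted (map_inj_uniq val_inj) undup_uniq.
exists g, k => f /gk <-; rewrite /c1; congr c; apply/eq_in_map => a aA.
rewrite (map_comp val (fun a => g (f a))) (map_pK valK).
by rewrite (nth_map a0) ?index_mem ?nth_index ?memA1.
Qed.
End Chain.

(** * Compactness through filters *)

Section CompactNbhs.
Variables (X : topologicalType) (Y : set X).
Hypothesis Y_compact : compact Y.

(** If no finite list worked, the points missed by finite lists would generate a proper filter; the
    list [[:: p]] excludes its cluster point [p]. *)
Lemma compact_finite_nbhs (N : X -> set X) :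
  (forall x, Y x -> nbhs x (N x)) ->
  exists s : seq X, forall y, Y y -> exists x, [/\ x \in s, Y x & N x y].
Proof.
move=> N_nbhs; apply: contrapT => /forallNP noN.
pose U (s : seq X) := [set y | Y y /\ forall x, x \in s -> Y x -> ~ N x y].
have UF : ProperFilter (filter_from [set: seq X] U).
  apply: filter_from_proper => [|s _].
    apply: filter_from_filter; first by exists [::].
    move=> s t _ _; exists (s ++ t) => // y [Yy yN].
    by split; split=> // x xs; apply: yN; rewrite mem_cat xs ?orbT.
  have /existsNP[y /not_implyP[Yy yN]] := noN s.
  by exists y; split=> // x xs Yx Nxy; apply: yN; exists x.
have [|p [Yp pU]] := Y_compact UF; first by exists [::] => // y [].
have [|y [[_ yN] Npy]] := pU (U [:: p]) (N p) _ (N_nbhs p Yp); first by exists [:: p].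
by apply: (yN p) => //; rewrite mem_head.
Qed.

(** The traces of the [Z i] on [Y] generate a proper filter, and a cluster point lies in every
    closed [Z i]. *)
Lemma compact_directed_inter (I : Type) (i0 : I) (Z : I -> set X) :
  (forall i, closed (Z i)) -> (forall i, Y `&` Z i !=set0) ->
  (forall i j, exists k, Z k `<=` Z i `&` Z j) ->
  exists x, Y x /\ forall i, Z i x.
Proof.
move=> Zcl Z0 Zdir.
have ZF : ProperFilter (filter_from [set: I] (fun i => Y `&` Z i)).
  apply: filter_from_proper => [|i _]; last exact: Z0.
  apply: filter_from_filter; first by exists i0.
  by move=> i j _ _; have [k kij] := Zdir i j; exists k => // y [Yy /kij[]].
have [|p [Yp pZ]] := Y_compact ZF; first by exists i0 => // y [].
exists p; split=> // i; apply: Zcl => B pB.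
have [|y [[_ Zy] By]] := pZ (Y `&` Z i) B _ pB; first by exists i.
by exists y.
Qed.
End CompactNbhs.

(** * Continuous actions and the fixed point property *)

Definition continuous_action (G : topologicalGroupType) (X : topologicalType)
    (act : G -> X -> X) : Prop :=
  [/\ forall x, act 1%g x = x,
      forall g h x, act (g * h)%g x = act g (act h x) &
      continuous (fun p : G * X => act p.1 p.2)].

(* Asking for the fixed point inside a given closed invariant set makes it
   possible to restrict actions without passing to subspaces. *)
Definition closed_fixed_point_property (G : topologicalGroupType) : Prop :=
  forall (X : topologicalType) (act : G -> X -> X) (Y : set X),
    compact [set: X] -> hausdorff_space X -> continuous_action act ->
    closed Y -> Y !=set0 -> (forall g x, Y x -> Y (act g x)) ->
    exists x, Y x /\ forall g, act g x = x.

Lemma closed_fixed_point_extremely_amenable G :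
  closed_fixed_point_property G -> extremely_amenable G.
Proof.
move=> GP X act X0 Xc Xh a1 aM ac.
have [//|x [_ xP]] := GP X act setT Xc Xh (And3 a1 aM ac) closedT X0.
by exists x.
Qed.

Section Action.
Variables (G : topologicalGroupType) (X : topologicalType) (act : G -> X -> X).
Hypothesis act_cont : continuous_action act.

Lemma act_continuous_r g : continuous (act g).
Proof.
have [_ _ ac] := act_cont; move=> x.
apply: (@continuous_comp _ _ _ (fun y => (g, y)) (fun p => act p.1 p.2)); last exact: ac.
by apply: cvg_pair; [exact: cvg_cst|exact: cvg_id].
Qed.

Lemma act_continuous_l x : continuous (act^~ x).
Proof.
have [_ _ ac] := act_cont; move=> g.
apply: (@continuous_comp _ _ _ (fun y => (y, x)) (fun p => act p.1 p.2)); last exact: ac.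
by apply: cvg_pair; [exact: cvg_id|exact: cvg_cst].
Qed.

Lemma actKV g x : act g (act g^-1%g x) = x.
Proof. by have [a1 aM _] := act_cont; rewrite -aM mulgV a1. Qed.

(** A fixed point near [x] is also near [act g x], so these two points cannot be separated. *)
Lemma closed_fixed (H : set G) : hausdorff_space X ->
  closed [set x | forall g, H g -> act g x = x].
Proof.
move=> Xh x xcl g Hg; apply: Xh => B C Bx Cx.
have [|y [yH [Cy By]]] := xcl (C `&` act g @^-1` B).
  by apply: filterI => //; exact: act_continuous_r.
by exists (act g y); split=> //; rewrite yH.
Qed.

Lemma hom_action (H : topologicalGroupType) (phi : H -> G) :
  phi 1%g = 1%g -> {morph phi : x y / (x * y)%g} -> continuous phi ->
  continuous_action (act \o phi).
Proof.
have [a1 aM ac] := act_cont; move=> p1 pM pc; split=> [x|g h x|[h x]] /=.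
- by rewrite p1 a1.
- by rewrite pM aM.
apply: (@continuous_comp _ _ _ (fun p : H * X => (phi p.1, p.2)) (fun p => act p.1 p.2)); last exact: ac.
apply: cvg_pair; last exact: cvg_snd.
by apply: (@continuous_comp _ _ _ fst phi (h, x)); [exact: cvg_fst|exact: pc].
Qed.
End Action.

(** * From the Ramsey property to fixed points *)

(** Stabilisers of finite lists generate a filter that converges pointwise to the identity. *)
Lemma nbhs1_aut (X : choiceType) (I : Type) (R : I -> rel X)
    (V : set (automorphism R)) : nbhs (1%g : automorphism R) V ->
  exists A : seq X, forall g : automorphism R, (forall x, x \in A -> g x = x) -> V g.
Proof.
pose U (A : seq X) := [set g : automorphism R | forall x, x \in A -> g x = x].
have UF : Filter (filter_from [set: seq X] U).
  apply: filter_from_filter; first by exists [::].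
  move=> A B _ _; exists (A ++ B) => // g gAB.
  by split=> x xA; apply: gAB; rewrite mem_cat xA ?orbT.
have cv : filter_from [set: seq X] U --> (1%g : automorphism R).
  by apply: cvg_aut => x; exists [:: x] => // g; apply; rewrite mem_head.
by move=> /cv [A _ AV]; exists A.
Qed.

(* The implication from the Ramsey property to extreme amenability of Kechris,
   Pestov and Todorcevic.  If there were no fixed point, finitely many
   neighbourhoods [N x] would cover the space, each one moved off itself by some
   [t x], even after perturbation by the stabiliser of a finite set [A].
   Colouring a copy [g A] by an [x] with [g^-1 y0] in [N x] contradicts the
   Ramsey property for the elements [1] and [(t x)^-1]. *)
Lemma ramsey_closed_fixed_point (X : choiceType) (I : Type) (R : I -> rel X) :
  (forall (C : finType) (c : seq X -> C) (A : seq X) (F : seq (automorphism R)),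
     exists (g : automorphism R) (k : C),
       forall f, f \in F -> c [seq (g * f)%g a | a <- A] = k) ->
  closed_fixed_point_property (automorphism R).
Proof.
set G := automorphism R => ram Z act Y Zc Zh act_cont Ycl [y0 Yy0] Yinv.
have [a1 aM ac] := act_cont.
apply: contrapT => /forallNP nofix.
(* [d] packs the element moving [x], the finite list and the neighbourhood; off [Y] its value is
   arbitrary. *)
have loc (x : Z) : exists d : G * seq X * set Z, Y x ->
    nbhs x d.2 /\
    forall (v w : G) u u', (forall a, a \in d.1.2 -> v a = a) ->
      (forall a, a \in d.1.2 -> w a = a) -> d.2 u -> d.2 u' ->
      act d.1.1 (act v u) <> act w u'.
  have [Yx|] := pselect (Y x); last by exists (1%g, [::], setT).
  have /not_andP[//|/existsNP[g gx]] := nofix x.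
  have xgx : x != act g x by apply/eqP => e; apply: gx.
  (* Disjoint [U] and [W] separate [x] from [act g x]; perturbed points of [N] lie in [U] and are
     sent into [W] by [g]. *)
  have := Zh; rewrite open_hausdorff => /(_ _ _ xgx)[[U W] /= [xU gxW] [Uo Wo UW]].
  have Ux : nbhs x (U `&` act g @^-1` W).
    apply: filterI; first by apply: open_nbhs_nbhs; split=> //; exact: set_mem.
    by apply: (act_continuous_r act_cont); apply: open_nbhs_nbhs; split=> //; exact: set_mem.
  rewrite -{1}(a1 x) in Ux.
  have [[V N] /= [V1 Nx] VN] := ac (1%g, x) _ Ux.
  have [A AV] := nbhs1_aut V1.
  exists (g, A, N) => _; split=> //= v w u u' vA wA Nu Nu' e.
  have [_ /= W1] := VN (v, u) (conj (AV _ vA) Nu).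
  have [U1 _] := VN (w, u') (conj (AV _ wA) Nu').
  move/eqP: UW => UW; have : (U `&` W) (act w u') by split=> //; rewrite -e.
  by rewrite UW.
have [d dP] := choice loc.
have Yc : compact Y by apply: subclosed_compact Zc _.
have [s sP] := compact_finite_nbhs Yc (fun x Yx => (dP x Yx).1).
have /choice[i iP] (g : G) : exists i : 'I_(size s),
    Y (nth y0 s i) /\ (d (nth y0 s i)).2 (act g^-1%g y0).
  have [x [xs Yx xN]] := sP (act g^-1%g y0) (Yinv _ _ Yy0).
  by exists (Ordinal (etrans (index_mem x s) xs)); rewrite /= nth_index.
pose A := flatten [seq (d x).1.2 | x <- s].
(* The [g'] picked by [xget] agrees with [g] only on [A], which is where the perturbations [v] and
   [w] come from. *)
pose c (a : seq X) := i (xget 1%g [set g : G | map g A = a]).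
have cP (g : G) x : nth y0 s (c (map g A)) = x ->
    [/\ x \in s, Y x & exists (v : G) u, [/\ forall a, a \in A -> v a = a,
       (d x).2 u & act g^-1%g y0 = act v u]].
  rewrite /c; set g' := xget _ _; have g'A : map g' A = map g A.
    by rewrite /g'; apply: (@xgetPex _ 1%g [set g' : G | map g' A = map g A]); exists g.
  move=> <-; have [Yx Nx] := iP g'; rewrite mem_nth //; split=> //.
  exists (g^-1 * g')%g, (act g'^-1%g y0); split=> //; last by rewrite -aM mulgK.
  move=> a aA; rewrite /= (_ : g' a = g a) ?autK //.
  by move/eq_in_map: g'A; apply.
(* The inverses of all the moving elements are included, as the colour [k] is not known in
   advance. *)
have [g [k gk]] := ram _ c A (1%g :: [seq (d x).1.1^-1%g | x <- s]).
set x := nth y0 s k.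
have [|xs Yx [v [u [vA Nu gE]]]] := cP g x.
  by rewrite -[g]mulg1 gk // mem_head.
have [|_ _ [w [u' [wA Nu' tE]]]] := cP (g * (d x).1.1^-1)%g x.
  by rewrite gk // inE (map_f (fun x => (d x).1.1^-1%g)) ?orbT.
have sub a : a \in (d x).1.2 -> a \in A.
  by move=> aA; apply/flattenP; exists (d x).1.2 => //; exact: (map_f (fun x => (d x).1.2)).
apply: ((dP x Yx).2 v w u u' _ _ Nu Nu') => [a /sub /vA //|a /sub /wA //|].
by rewrite -gE -tE invgM invgK aM.
Qed.

(** * Chains, trivial groups and commuting families *)

Lemma chain_closed_fixed_point (num : rat -> nat) (P : pred rat) :
  dense_partition num -> (forall q q', num q = num q' -> P q = P q') ->
  closed_fixed_point_property (automorphism (@chain_rel num P)).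
Proof. by move=> dn Pn; apply: ramsey_closed_fixed_point; exact: chain_ramsey. Qed.

Lemma trivial_closed_fixed_point (G : topologicalGroupType) :
  (forall g : G, g = 1%g) -> closed_fixed_point_property G.
Proof.
move=> G1 X act Y _ _ [a1 _ _] _ [x Yx] _.
by exists x; split=> // g; rewrite (G1 g) a1.
Qed.

(** By compactness finitely many indices suffice, and they are added one at a time: [H j] preserves
    the common fixed points of the groups commuting with it. *)
Lemma commuting_fixed_point (G : topologicalGroupType) (X : topologicalType)
    (act : G -> X -> X) (Y : set X) (J : eqType) (H : J -> topologicalGroupType)
    (phi : forall j, H j -> G) :
  compact [set: X] -> hausdorff_space X -> continuous_action act ->
  closed Y -> Y !=set0 -> (forall g x, Y x -> Y (act g x)) ->
  (forall j, closed_fixed_point_property (H j)) ->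
  (forall j, phi j 1%g = 1%g) ->
  (forall j, {morph (phi j) : x y / (x * y)%g}) ->
  (forall j, continuous (phi j)) ->
  (forall i j g h, i != j -> (phi i g * phi j h)%g = (phi j h * phi i g)%g) ->
  exists x, Y x /\ forall j h, act (phi j h) x = x.
Proof.
move=> Xc Xh act_cont Ycl Y0 Yinv HP phi1 phiM phic phiC.
have [a1 aM _] := act_cont.
have Yc : compact Y by apply: subclosed_compact Xc _.
pose Z (s : seq J) := [set x | forall g, (exists j h, j \in s /\ g = phi j h) -> act g x = x].
have Zcl s : closed (Z s) by exact: (closed_fixed act_cont).
have [||x [Yx xZ]] := compact_directed_inter Yc [::] Zcl; last first.
- by exists x; split=> // j h; apply: (xZ [:: j]); exists j, h; rewrite mem_head.
- move=> s t; exists (s ++ t) => x xst.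
  by split=> g [j [h [js ->]]]; apply: xst; exists j, h; rewrite mem_cat js ?orbT.
elim=> [|j s IHs]; first by have [x Yx] := Y0; exists x; split=> // g [j [h []]].
have [js|jNs] := boolP (j \in s).
  have [x [Yx xs]] := IHs; exists x; split=> // g [i [h [ijs ->]]]; apply: xs.
  by exists i, h; split=> //; move: ijs; rewrite inE => /predU1P[->|].
have [|h x [Yx xs]|x [[Yx xs] xj]] :=
  HP j X (act \o phi j) (Y `&` Z s) Xc Xh (hom_action act_cont (phi1 j) (phiM j) (phic j)) _ IHs.
- exact: closedI.
- split; first exact: Yinv.
  move=> _ [i [k [iS ->]]] /=; rewrite -aM phiC; last by apply: contraNneq jNs => <-.
  by rewrite aM (xs (phi i k)) //; exists i, k.
- exists x; split=> // _ [i [h [+ ->]]]; rewrite inE => /predU1P[ij|iS].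
    by move: h; rewrite ij => h; exact: xj.
  by apply: xs; exists i, h.
Qed.

(** * Trees, and automorphisms as maps of bare sequences *)

(** Subtrees sit inside a sequence, so the recursion is nested. Reading them by [nth] spares a bound
    on [i]: out of range the claim is the one for the leaf. *)
Lemma tree_presentation_nested_ind (P : tree_presentation -> Prop) :
  P tree_one ->
  (forall T, root_label T <> leaf_label ->
     (forall i, P (nth tree_one (subtrees T) i)) -> P T) ->
  forall T, P T.
Proof.
move=> P1 Pn.
pose subind (IH : forall T, P T) := fix subind Ts i : P (nth tree_one Ts i) :=
  match Ts, i with
  | [::], 0 | [::], _.+1 => P1
  | T :: _, 0 => IH T
  | _ :: Ts', i'.+1 => subind Ts' i'
  end.
exact (fix IH T : P T :=
  match T return P T with
  | tree_one => P1
  | tree_sum T1 Ts => Pn (tree_sum T1 Ts) (fun e => ltac:(discriminate e))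
      (fun i => match i with 0 => IH T1 | i'.+1 => subind IH Ts i' end)
  | tree_shuffle T1 Ts => Pn (tree_shuffle T1 Ts) (fun e => ltac:(discriminate e))
      (fun i => match i with 0 => IH T1 | i'.+1 => subind IH Ts i' end)
  end).
Qed.

Section Tree.
Variable num : rat -> nat.
Hypothesis num_part : dense_partition num.

Section Node.
Variable T : tree_presentation.

Definition child (q : rat) : tree_presentation := nth tree_one (subtrees T) (num q).-1.

Definition is_head (q : rat) : bool :=
  (num q <= size (subtrees T))%N &&
  (if root_label T is sum_label then q == (num q)%:R%R else true).

Lemma label_at_cons q t : (num q <= size (subtrees T))%N ->
  label_at T (num q :: t) = label_at (child q) t.
Proof.
rewrite /child; have := num_gt0 num_part q; case: (num q) => //= i _ iT.
by rewrite onthE (nth_map tree_one).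
Qed.

(** The condition at index 0 concerns the root, and the one at [i.+1] is the condition at [i] in the
    child. *)
Lemma in_L_cons q r : in_L num T (q :: r) = is_head q && in_L num (child q) r.
Proof.
have [qT|qNT] := leqP (num q) (size (subtrees T)); last first.
  rewrite /is_head leqNgt qNT /= /in_L /is_leaf /=.
  move: qNT (num_gt0 num_part q); case: (num q) => //= i iT _.
  by rewrite onth_default.
rewrite /in_L /is_head qT /is_leaf [map _ _]/= label_at_cons // [RHS]andbCA; congr (_ && _).
apply/forallP/andP => [qr|[q0 /forallP r0] [[|i] iq]] /=.
- split; first by have := qr ord0; rewrite /is_sum /=; case: root_label.
  apply/forallP => i; have := qr (lift ord0 i).
  by rewrite /= /is_sum label_at_cons.
- by move: q0; rewrite /is_sum /=; case: root_label.
by have := r0 (Ordinal (iq : (i < size r)%N)); rewrite /is_sum label_at_cons.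
Qed.

Lemma is_node_cons q t : (num q <= size (subtrees T))%N ->
  is_node T (num q :: t) = is_node (child q) t.
Proof. by move=> qT; rewrite /is_node label_at_cons. Qed.
End Node.

(** This is [L_E] on bare sequences, a type shared by the orders of a tree and of its subtrees. *)
Definition seq_E (t : seq nat) (r s : seq rat) : bool :=
  [&& prefix t (map num r), prefix t (map num s) & take (size t) r == take (size t) s].

Lemma seq_E_nil r s : seq_E [::] r s.
Proof. by rewrite /seq_E !prefix0s !take0 eqxx. Qed.

Lemma seq_E_cons i t q r q' s :
  seq_E (i :: t) (q :: r) (q' :: s) = [&& num q == i, q == q' & seq_E t r s].
Proof.
rewrite /seq_E /= !(eq_sym i) eqseq_cons.
case: (q =P q') => [->|_]; last by rewrite !andbF.
by case: eqP => //= _; rewrite !andbF.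
Qed.

Section SeqAut.
Variable T : tree_presentation.
Local Notation G := (automorphism (@L_star num T)).

(** The value outside L_T is a convention, chosen so that the identity acts as the identity
    everywhere. *)
Definition aut_seq (f : G) (r : seq rat) : seq rat :=
  if insub r is Some x then val (f x) else r.

Lemma aut_seq_val (f : G) (x : L num T) : aut_seq f (val x) = val (f x).
Proof. by rewrite /aut_seq valK. Qed.

Lemma aut_seqP (f : G) r : in_L num T r -> in_L num T (aut_seq f r).
Proof. by move=> rL; rewrite -[r](@SubK _ _ (L num T) _ rL) aut_seq_val (valP (f _)). Qed.

Lemma aut_seq1 r : aut_seq 1%g r = r.
Proof. by rewrite /aut_seq; case: insubP => // x _ ->. Qed.

Lemma aut_seqM (f g : G) r : in_L num T r ->
  aut_seq (f * g)%g r = aut_seq f (aut_seq g r).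
Proof. by move=> rL; rewrite -[r](@SubK _ _ (L num T) _ rL) !aut_seq_val. Qed.

Lemma aut_seqK (f : G) r : in_L num T r -> aut_seq f^-1%g (aut_seq f r) = r.
Proof. by move=> rL; rewrite -aut_seqM // mulVg aut_seq1. Qed.

Lemma aut_seqKV (f : G) r : in_L num T r -> aut_seq f (aut_seq f^-1%g r) = r.
Proof. by move=> rL; rewrite -aut_seqM // mulgV aut_seq1. Qed.

Lemma aut_seq_lt (f : G) r s : in_L num T r -> in_L num T s ->
  (aut_seq f r < aut_seq f s :> seqlexi rat)%O = (r < s :> seqlexi rat)%O.
Proof.
move=> rL sL; rewrite -[r](@SubK _ _ (L num T) _ rL) -[s](@SubK _ _ (L num T) _ sL) !aut_seq_val.
exact: (aut_rel f (symbol_lt T)).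
Qed.

Lemma aut_seq_E (f : G) t r s : is_node T t -> in_L num T r -> in_L num T s ->
  seq_E t (aut_seq f r) (aut_seq f s) = seq_E t r s.
Proof.
move=> tT rL sL; rewrite -[r](@SubK _ _ (L num T) _ rL) -[s](@SubK _ _ (L num T) _ sL) !aut_seq_val.
exact: (aut_rel f (symbol_E tT)).
Qed.

Lemma seq_aut (a b : seq rat -> seq rat) :
  (forall r, in_L num T r -> in_L num T (a r)) ->
  (forall r, in_L num T r -> in_L num T (b r)) ->
  (forall r, in_L num T r -> b (a r) = r) ->
  (forall r, in_L num T r -> a (b r) = r) ->
  (forall r s, in_L num T r -> in_L num T s ->
     (a r < a s :> seqlexi rat)%O = (r < s :> seqlexi rat)%O) ->
  (forall t r s, is_node T t -> in_L num T r -> in_L num T s ->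
     seq_E t (a r) (a s) = seq_E t r s) ->
  exists g : G, forall r, in_L num T r -> aut_seq g r = a r.
Proof.
move=> aL bL aK bK a_lt a_E.
pose f (x : L num T) : L num T := Sub (a (val x)) (aL _ (valP x)).
have f_bij : bijective f.
  by exists (fun x : L num T => Sub (b (val x)) (bL _ (valP x))) => x;
    apply: val_inj; rewrite /= ?aK ?bK // (valP x).
have f_rel c x y : L_star c (f x) (f y) = L_star c x y.
  case: c => [|t tT] /=; first exact: (a_lt _ _ (valP x) (valP y)).
  exact: (a_E _ _ _ tT (valP x) (valP y)).
exists (Automorphism f_bij f_rel) => r rL.
by rewrite -[r](@SubK _ _ (L num T) _ rL) aut_seq_val.
Qed.

Lemma aut_seq_ext (f g : G) :
  (forall r, in_L num T r -> aut_seq f r = aut_seq g r) -> f = g.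
Proof.
move=> fg; apply: aut_ext => x; apply: val_inj.
by rewrite -!aut_seq_val fg // (valP x).
Qed.
End SeqAut.
End Tree.

(** * Automorphisms at a node: those of one block and those of the heads *)

Lemma seqlexi_lt_cons (q q' : rat) (r s : seq rat) :
  (q :: r < q' :: s :> seqlexi rat)%O =
  if q == q' then (r < s :> seqlexi rat)%O else (q < q')%R.
Proof.
by case: eqVneq => [->|qq']; [exact: eqhead_ltxiE|exact: neqhead_ltxiE].
Qed.

Section NodeGroup.
Variables (num : rat -> nat) (num_part : dense_partition num) (T : tree_presentation).
Hypothesis T_node : root_label T <> leaf_label.
Local Notation G := (automorphism (@L_star num T)).
Local Notation M := {q : rat | is_head num T q}.
Local Notation H := (automorphism (@chain_rel num (is_head num T))).

Variant in_L_node_spec : seq rat -> Prop :=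
  InLNode q r of is_head num T q & in_L num (child num T q) r : in_L_node_spec (q :: r).

Lemma in_L_nodeP r : in_L num T r -> in_L_node_spec r.
Proof.
case: r => [|q r]; first by rewrite /in_L /is_leaf /=; case: root_label T_node.
by rewrite in_L_cons // => /andP[qT rL]; constructor.
Qed.

Lemma head_le q : is_head num T q -> (num q <= size (subtrees T))%N.
Proof. by case/andP. Qed.

Section Block.
Variable q0 : rat.
Local Notation K := (automorphism (@L_star num (child num T q0))).

(** Only sequences with head [q0] are moved; if [q0] is not a head, the map is the identity on
    L_T. *)
Definition block_map (f : K) (s : seq rat) : seq rat :=
  if s is q :: r then if q == q0 then q :: aut_seq f r else s else s.

Lemma block_map_in (f : K) r : in_L num T r -> in_L num T (block_map f r).
Proof.
move=> /in_L_nodeP[{}q {}r qT rL] /=; case: eqP => [qq0|_]; rewrite in_L_cons // qT //=.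
by subst q; exact: aut_seqP.
Qed.

Lemma block_mapM (f g : K) r : in_L num T r ->
  block_map (f * g)%g r = block_map f (block_map g r).
Proof.
move=> /in_L_nodeP[{}q {}r qT rL] /=; case: (q =P q0) => [qq0|/eqP qq0] /=.
  by subst q; rewrite eqxx aut_seqM.
by rewrite (negbTE qq0).
Qed.

Lemma block_map1 r : block_map 1%g r = r.
Proof. by case: r => //= q r; rewrite aut_seq1; case: ifP. Qed.

(** Comparisons across blocks are decided by the heads; those inside the block of [q0] reduce to
    relations of its child, which [f] preserves. *)
Lemma block_ex (f : K) : exists g : G, forall r, in_L num T r -> aut_seq g r = block_map f r.
Proof.
apply: (@seq_aut _ _ _ (block_map f^-1%g)).
- exact: block_map_in.
- exact: block_map_in.
- by move=> r rL; rewrite -block_mapM // mulVg block_map1.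
- by move=> r rL; rewrite -block_mapM // mulgV block_map1.
- move=> _ _ /in_L_nodeP[q r qT rL] /in_L_nodeP[q' s q'T sL] /=.
  have [qq0|] := eqVneq q q0; have [q'q0|] := eqVneq q' q0; rewrite !seqlexi_lt_cons.
  + by subst q q'; rewrite eqxx aut_seq_lt.
  + by rewrite qq0 eq_sym => /negbTE ->.
  + by rewrite q'q0 => /negbTE ->.
  + by [].
- move=> [|i t] _ _ tT /in_L_nodeP[q r qT rL] /in_L_nodeP[q' s q'T sL]; first by rewrite !seq_E_nil.
  rewrite /block_map; have [qq0|] := eqVneq q q0; have [q'q0|] := eqVneq q' q0; rewrite !seq_E_cons.
  + subst q q'; case: eqP => //= qi; rewrite eqxx /= aut_seq_E //.
    by rewrite -is_node_cons ?qi ?head_le // -qi head_le.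
  + by rewrite qq0 eq_sym => /negbTE ->; rewrite !andbF.
  + by rewrite q'q0 => /negbTE ->; rewrite !andbF.
  + by [].
Qed.

Definition block (f : K) : G := projT1 (cid (block_ex f)).

Lemma blockE (f : K) r : in_L num T r -> aut_seq (block f) r = block_map f r.
Proof. by rewrite /block; case: cid => g gE; exact: gE. Qed.

Lemma block1 : block 1%g = 1%g.
Proof. by apply: aut_seq_ext => r rL; rewrite blockE // block_map1 aut_seq1. Qed.

Lemma blockM : {morph block : f g / (f * g)%g}.
Proof.
move=> f g; apply: aut_seq_ext => r rL.
by rewrite aut_seqM // !blockE // ?block_mapM //; exact: block_map_in.
Qed.

(** The value of [block k] at [x] depends only on that of [k] at the tail of [x]. *)
Lemma block_continuous : continuous block.
Proof.
move=> f; apply: (@cvg_aut _ _ _ _ _ (fmap_filter _ (nbhs_filter f))) => x.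
have blk k : aut_seq k (behead (val x)) = aut_seq f (behead (val x)) -> block k x = block f x.
  move=> kf; apply: val_inj; rewrite -!aut_seq_val !blockE ?(valP x) //.
  by move: kf; case: (val x) => //= q r ->.
have [rL|rNL] := boolP (in_L num (child num T q0) (behead (val x))); last first.
  apply: (@filterS _ _ (nbhs_filter f)) (@filterT _ _ (nbhs_filter f)) => k _ /=; apply: blk.
  by rewrite /aut_seq insubN.
apply: (@filterS _ _ (nbhs_filter f)) (aut_eval_nbhs f (Sub _ rL)) => k /= kf; apply: blk.
by rewrite -[behead _](@SubK _ _ (L num (child num T q0)) _ rL) !aut_seq_val kf.
Qed.
End Block.

Lemma block_commute q q' f g : q != q' ->
  (block (q0 := q) f * block (q0 := q') g)%g = (block (q0 := q') g * block (q0 := q) f)%g.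
Proof.
move=> qq'; apply: aut_seq_ext => r rL.
rewrite !aut_seqM // !blockE //; try exact: block_map_in.
case: r {rL} => //= p r.
have [->|pq] := eqVneq p q; first by rewrite (negbTE qq') /= eqxx (negbTE qq').
by case: ifP => /= ->; rewrite ?(negbTE pq).
Qed.

Definition head_map (h : H) (q : rat) : rat :=
  if insub q is Some x then val (h x : M) else q.

Lemma head_map_val (h : H) (x : M) : head_map h (val x) = val (h x).
Proof. by rewrite /head_map valK. Qed.

Lemma head_mapP (h : H) q : is_head num T q -> is_head num T (head_map h q).
Proof. by move=> qT; rewrite -[q](@SubK _ _ M _ qT) head_map_val (valP (h _)). Qed.

Lemma head_map_num (h : H) q : is_head num T q -> num (head_map h q) = num q.
Proof. by move=> qT; rewrite -[q](@SubK _ _ M _ qT) head_map_val chain_aut_num. Qed.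

Lemma head_map_lt (h : H) q q' : is_head num T q -> is_head num T q' ->
  (head_map h q < head_map h q')%R = (q < q')%R.
Proof.
move=> qT q'T; rewrite -[q](@SubK _ _ M _ qT) -[q'](@SubK _ _ M _ q'T) !head_map_val.
exact: chain_aut_lt.
Qed.

Lemma head_map_eq (h : H) q q' : is_head num T q -> is_head num T q' ->
  (head_map h q == head_map h q') = (q == q').
Proof. by move=> qT q'T; rewrite !eq_le !leNgt !head_map_lt. Qed.

Lemma head_mapM (h k : H) q : is_head num T q ->
  head_map (h * k)%g q = head_map h (head_map k q).
Proof. by move=> qT; rewrite -[q](@SubK _ _ M _ qT) !head_map_val. Qed.

Lemma head_map1 q : head_map 1%g q = q.
Proof. by rewrite /head_map; case: insubP => // x _ ->. Qed.

(** This splits the projection onto heads: the tail can be kept because the child depends only on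
    the colour of the head, which [h] preserves. *)
Definition lift_map (h : H) (s : seq rat) : seq rat :=
  if s is q :: r then head_map h q :: r else s.

Lemma child_head_map (h : H) q : is_head num T q ->
  child num T (head_map h q) = child num T q.
Proof. by move=> qT; rewrite /child head_map_num. Qed.

Lemma lift_map_in (h : H) r : in_L num T r -> in_L num T (lift_map h r).
Proof.
by move=> /in_L_nodeP[{}q {}r qT rL] /=; rewrite in_L_cons // head_mapP ?child_head_map.
Qed.

Lemma lift_mapM (h k : H) r : in_L num T r ->
  lift_map (h * k)%g r = lift_map h (lift_map k r).
Proof. by move=> /in_L_nodeP[{}q {}r qT rL] /=; rewrite head_mapM. Qed.

Lemma lift_map1 r : lift_map 1%g r = r.
Proof. by case: r => //= q r; rewrite head_map1. Qed.

Lemma lift_ex (h : H) : exists g : G, forall r, in_L num T r -> aut_seq g r = lift_map h r.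
Proof.
apply: (@seq_aut _ _ _ (lift_map h^-1%g)).
- exact: lift_map_in.
- exact: lift_map_in.
- by move=> r rL; rewrite -lift_mapM // mulVg lift_map1.
- by move=> r rL; rewrite -lift_mapM // mulgV lift_map1.
- move=> _ _ /in_L_nodeP[q r qT rL] /in_L_nodeP[q' s q'T sL] /=.
  by rewrite !seqlexi_lt_cons head_map_eq // head_map_lt.
- move=> [|i t] _ _ tT /in_L_nodeP[q r qT rL] /in_L_nodeP[q' s q'T sL]; first by rewrite !seq_E_nil.
  by rewrite !seq_E_cons head_map_eq // head_map_num.
Qed.

Definition lift_aut (h : H) : G := projT1 (cid (lift_ex h)).

Lemma lift_autE (h : H) r : in_L num T r -> aut_seq (lift_aut h) r = lift_map h r.
Proof. by rewrite /lift_aut; case: cid => g gE; exact: gE. Qed.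

Lemma lift_aut1 : lift_aut 1%g = 1%g.
Proof. by apply: aut_seq_ext => r rL; rewrite lift_autE // lift_map1 aut_seq1. Qed.

Lemma lift_autM : {morph lift_aut : f g / (f * g)%g}.
Proof.
move=> f g; apply: aut_seq_ext => r rL.
by rewrite aut_seqM // !lift_autE // ?lift_mapM //; exact: lift_map_in.
Qed.

Lemma lift_aut_continuous : continuous lift_aut.
Proof.
move=> h; apply: (@cvg_aut _ _ _ _ _ (fmap_filter _ (nbhs_filter h))) => x.
have qT : is_head num T (head 0%R (val x)) by case: (in_L_nodeP (valP x)).
apply: (@filterS _ _ (nbhs_filter h)) (aut_eval_nbhs h (Sub _ qT)) => k /= kh.
apply: val_inj; rewrite -!aut_seq_val !lift_autE ?(valP x) //.
have : head_map k (head 0%R (val x)) = head_map h (head 0%R (val x)).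
  by rewrite -[head _ _](@SubK _ _ M _ qT) !head_map_val kh.
by case: (val x) => //= q r ->.
Qed.
End NodeGroup.

(** * The extension at a node and its fixed points *)

Section NodeFixedPoint.
Variables (num : rat -> nat) (num_part : dense_partition num).

Lemma in_L_inhabited T : exists r, in_L num T r.
Proof.
elim/tree_presentation_nested_ind: T => [|T T_node IH].
  by exists [::]; rewrite /in_L /=; apply/forallP => -[].
(* 1 is a head at sums and shuffles alike: its colour is 1 and there is a first subtree. *)
have num1 : num 1%R = 1%N by exact: (num_nat num_part (ltn0Sn 0)).
have [r rL] := IH 0%N; exists (1%R :: r); rewrite in_L_cons // /child /is_head num1 rL.
by case: T T_node {IH rL} => //= *; rewrite eqxx.
Qed.

Variable T : tree_presentation.
Hypothesis T_node : root_label T <> leaf_label.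
Local Notation G := (automorphism (@L_star num T)).
Local Notation M := {q : rat | is_head num T q}.
Local Notation H := (automorphism (@chain_rel num (is_head num T))).

(** For a node of length one, [seq_E] says that both heads have that colour and are equal;
    preserving it preserves colours and equality of heads. *)
Lemma aut_seq_head (g : G) r s : in_L num T r -> in_L num T s ->
  num (head 0%R (aut_seq g r)) = num (head 0%R r) /\
  (head 0%R (aut_seq g r) == head 0%R (aut_seq g s)) = (head 0%R r == head 0%R s).
Proof.
move=> rL sL; have tT : is_node T [:: num (head 0%R r)].
  have [q r' qT _] := in_L_nodeP num_part T_node rL.
  by rewrite /= is_node_cons // head_le.
have E u v : in_L num T u -> in_L num T v ->
    seq_E num [:: num (head 0%R r)] u v =
    (num (head 0%R u) == num (head 0%R r)) && (head 0%R u == head 0%R v).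
  move=> /(in_L_nodeP num_part T_node)[q u' _ _] /(in_L_nodeP num_part T_node)[q' v' _ _].
  by rewrite seq_E_cons seq_E_nil andbT.
have grL := aut_seqP g rL; have gsL := aut_seqP g sL.
have := aut_seq_E g tT rL rL; rewrite !E // !eqxx !andbT => /eqP gr.
by split=> //; have := aut_seq_E g tT rL sL; rewrite !E // gr !eqxx.
Qed.

(** The kernel of the projection onto heads. *)
Definition head_preserving (g : G) : Prop :=
  forall r, in_L num T r -> head 0%R (aut_seq g r) = head 0%R r.

Lemma head_preserving_inv (g : G) : head_preserving g -> head_preserving g^-1%g.
Proof. by move=> gh r rL; rewrite -gh ?aut_seqKV // aut_seqP. Qed.

Lemma head_preserving_conj (g h : G) : head_preserving g -> head_preserving (h^-1 * g * h)%g.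
Proof.
move=> gh r rL; rewrite !aut_seqM ?aut_seqP //; apply/eqP.
rewrite -{2}(aut_seqK h rL) (aut_seq_head _ _ _).2 ?gh ?aut_seqP //.
Qed.

Lemma head_preserving_cons (g : G) q r : head_preserving g ->
  in_L num T (q :: r) -> aut_seq g (q :: r) = q :: behead (aut_seq g (q :: r)).
Proof.
move=> gh qrL; have := gh _ qrL.
by have [p s _ _] := in_L_nodeP num_part T_node (aut_seqP g qrL) => /= ->.
Qed.

(** [g] maps the block of [q] to itself, and removing [q] turns this action into an automorphism of
    the child. *)
Lemma head_preserving_restrict (g : G) q : head_preserving g -> is_head num T q ->
  exists f : automorphism (@L_star num (child num T q)),
    forall r, in_L num (child num T q) r -> q :: aut_seq f r = aut_seq g (q :: r).
Proof.
move=> gh qT; have ghV := head_preserving_inv gh.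
have consL r : in_L num (child num T q) r -> in_L num T (q :: r) by rewrite in_L_cons // qT.
have beheadL k r : head_preserving k -> in_L num (child num T q) r ->
    in_L num (child num T q) (behead (aut_seq k (q :: r))).
  move=> kh rL; have := aut_seqP k (consL r rL).
  by rewrite {1}(head_preserving_cons kh (consL r rL)) in_L_cons // => /andP[].
have [|||||| f fE] := @seq_aut num (child num T q) (fun r => behead (aut_seq g (q :: r)))
  (fun r => behead (aut_seq g^-1%g (q :: r))).
- by move=> r; exact: beheadL.
- by move=> r; exact: beheadL.
- by move=> r rL; rewrite -(head_preserving_cons gh (consL r rL)) aut_seqK ?consL.
- by move=> r rL; rewrite -(head_preserving_cons ghV (consL r rL)) aut_seqKV ?consL.
- move=> r s rL sL; have := aut_seq_lt g (consL r rL) (consL s sL).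
  rewrite (head_preserving_cons gh (consL r rL)) (head_preserving_cons gh (consL s sL)).
  by rewrite !seqlexi_lt_cons eqxx.
- move=> t r s tT rL sL; have := aut_seq_E g (t := num q :: t) _ (consL r rL) (consL s sL).
  rewrite is_node_cons ?head_le // => /(_ tT).
  rewrite (head_preserving_cons gh (consL r rL)) (head_preserving_cons gh (consL s sL)).
  by rewrite !seq_E_cons !eqxx.
by exists f => r rL; rewrite fE // -(head_preserving_cons gh (consL r rL)).
Qed.

(** The image of a head is read off an arbitrary sequence with that head; by [aut_seq_head] the
    choice is irrelevant. *)
Lemma head_aut_ex (g : G) :
  exists h : H, forall r, in_L num T r -> head 0%R (aut_seq g r) = head_map h (head 0%R r).
Proof.
have consL (q : M) : exists r, in_L num T (val q :: r).
  have [r rL] := in_L_inhabited (child num T (val q)); exists r.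
  by rewrite in_L_cons // (valP q).
have [r rL] := choice consL.
have headT s : in_L num T s -> is_head num T (head 0%R s).
  by move=> /(in_L_nodeP num_part T_node)[].
pose e (k : G) (q : M) : M := Sub _ (headT _ (aut_seqP k (rL q))).
have eE k s (sL : in_L num T s) : head 0%R (aut_seq k s) = val (e k (Sub _ (headT s sL))).
  by have [_] := aut_seq_head k sL (rL (Sub _ (headT s sL))); rewrite /= eqxx => /eqP.
have eK k q : e k^-1%g (e k q) = q.
  apply: val_inj; have := eE k^-1%g _ (aut_seqP k (rL q)).
  rewrite aut_seqK // => /= ->; congr (val (e _ _)); exact: val_inj.
have e_bij : bijective (e g).
  by exists (e g^-1%g) => q; [|have := eK g^-1%g q; rewrite invgK].
have e_lt q q' : (val (e g q) < val (e g q'))%R = (val q < val q')%R.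
  have [_] := aut_seq_head g (rL q) (rL q').
  have := aut_seq_lt g (rL q) (rL q'); rewrite /e /=.
  have [p s _ _] := in_L_nodeP num_part T_node (aut_seqP g (rL q)).
  have [p' s' _ _] := in_L_nodeP num_part T_node (aut_seqP g (rL q')).
  (* Distinct heads stay distinct, and then the lexicographic comparison is that of the heads. *)
  rewrite !seqlexi_lt_cons /= => + pp'; rewrite pp'.
  by case: (val q =P val q') pp' => // -> /eqP -> _; rewrite !ltxx.
have e_rel a q q' : chain_rel num a (e g q) (e g q') = chain_rel num a q q'.
  case: a => [n|]; last exact: e_lt.
  by rewrite /= (aut_seq_head g (rL q) (rL q)).1.
exists (Automorphism e_bij e_rel) => s sL.
by rewrite eE -[head _ s in RHS](@SubK _ _ M _ (headT s sL)) head_map_val.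
Qed.

(** On sequences with finitely many given heads [g] agrees with a product of block automorphisms, so
    it is a limit of elements fixing [x]. *)
Lemma head_preserving_fixed (X : topologicalType) (act : G -> X -> X) (x : X) :
  hausdorff_space X -> continuous_action act ->
  (forall q f, act (@block num num_part T T_node q f) x = x) ->
  forall g, head_preserving g -> act g x = x.
Proof.
move=> Xh act_cont xfix g gh; have [a1 aM _] := act_cont.
have approx (s : seq rat) : exists k : G, act k x = x /\ forall r, in_L num T r ->
    aut_seq k r = if head 0%R r \in s then aut_seq g r else r.
  elim: s => [|q s [k [kx kE]]]; first by exists 1%g; split=> // r _; rewrite aut_seq1.
  have [qs|qs] := boolP ((q \in s) || ~~ is_head num T q).
    exists k; split=> // r rL; rewrite kE // inE; congr (if _ then _ else _).
    case: eqP => //= rq; move: qs; rewrite -rq; case: (_ \in s) => //=.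
    by have [p r' -> _] := in_L_nodeP num_part T_node rL.
  move: qs; rewrite negb_or negbK => /andP[qs qT].
  have [f fE] := head_preserving_restrict gh qT.
  exists (block num_part T_node f * k)%g; split=> [|r rL]; first by rewrite aM kx xfix.
  rewrite aut_seqM // blockE ?aut_seqP // kE // inE.
  have := gh _ rL; have := aut_seqP g rL.
  move: (rL) => /(in_L_nodeP num_part T_node)[p u pT uL] gL /= gp.
  have [pq|pq] /= := eqVneq p q.
    by subst p; rewrite (negbTE qs) /= eqxx fE.
  case: ifP => _ /=; last by rewrite (negbTE pq).
  by move: gp; case: (aut_seq g _) => //= p' v ->; rewrite (negbTE pq).
pose U (s : seq (L num T)) := [set k : G | act k x = x /\ forall y, y \in s -> k y = g y].
have UF : ProperFilter (filter_from [set: seq (L num T)] U).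
  apply: filter_from_proper => [|s _].
    apply: filter_from_filter; first by exists [::].
    move=> s t _ _; exists (s ++ t) => // k [kx kst].
    by split; split=> // y ys; apply: kst; rewrite mem_cat ys ?orbT.
  have [k [kx kE]] := approx [seq head 0%R (val y) | y <- s].
  exists k; split=> // y ys; apply: val_inj; rewrite -!aut_seq_val kE ?(valP y) //.
  by rewrite (map_f (fun y : L num T => head 0%R (val y)) ys).
have Ug : filter_from [set: seq (L num T)] U --> g.
  by apply: cvg_aut => y; exists [:: y] => // k [_]; apply; rewrite mem_head.
apply: (@closed_cvg _ _ _ UF (act^~ x) [set x]).
- exact: (accessible_closed_set1 (hausdorff_accessible Xh)).
- by exists [::] => // k [].
- exact: cvg_trans (cvg_app _ Ug) (@act_continuous_l _ _ _ act_cont x g).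
Qed.

(* [Fix N], for the normal subgroup [N] of the automorphisms preserving heads,
   is nonempty because [N] is the closure of a direct sum of groups of
   subtrees; the group of the chain of heads then acts on it. *)
Lemma node_closed_fixed_point :
  (forall q, closed_fixed_point_property (automorphism (@L_star num (child num T q)))) ->
  closed_fixed_point_property H -> closed_fixed_point_property G.
Proof.
move=> childP HP X act Y Xc Xh act_cont Ycl Y0 Yinv.
have [a1 aM _] := act_cont.
have [x [Yx xfix]] : exists x, Y x /\
    forall q f, act (@block num num_part T T_node q f) x = x.
  apply: (commuting_fixed_point Xc Xh act_cont Ycl Y0 Yinv childP).
  - by move=> q; exact: block1.
  - by move=> q; exact: blockM.
  - by move=> q; exact: block_continuous.
  - by move=> p q f g; exact: block_commute.
pose Z := Y `&` [set z | forall g, head_preserving g -> act g z = z].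
have [||h z [Yz zfix]|z [[Yz zfix] zH]] := HP X (act \o @lift_aut num num_part T T_node) Z Xc Xh
  (hom_action act_cont (lift_aut1 num_part T_node) (lift_autM num_part T_node)
     (@lift_aut_continuous _ num_part T T_node)).
- by apply: closedI => //; exact: closed_fixed.
- by exists x; split=> //; exact: head_preserving_fixed.
- split; first exact: Yinv.
  (* Normality: the conjugate of [g] by [k] also preserves heads, hence fixes [z]. *)
  move=> g gh /=; set k := lift_aut _ _ _.
  by rewrite -{2}(zfix _ (head_preserving_conj k gh)) !aM (actKV act_cont).
exists z; split=> // g.
(* [k] lifts the action of [g] on heads, so [g] is [k] times a head-preserving automorphism. *)
have [h hE] := head_aut_ex g; set k := lift_aut num_part T_node h.
have kg : head_preserving (k^-1 * g)%g.
  move=> r rL; rewrite aut_seqM //; apply/eqP.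
  rewrite -{2}(aut_seqK k rL) (aut_seq_head _ _ _).2 ?aut_seqP // hE // lift_autE //.
  by have [q s _ _] := in_L_nodeP num_part T_node rL.
by rewrite -(actKV act_cont k (act g z)) -(aM k^-1%g) (zfix _ kg); exact: zH.
Qed.
End NodeFixedPoint.

(** * Induction on the tree *)

Theorem theorem5 (num : rat -> nat) (num_part : dense_partition num)
    (T : tree_presentation) :
  extremely_amenable (automorphism (@L_star num T)).
Proof.
apply: closed_fixed_point_extremely_amenable.
elim/tree_presentation_nested_ind: T => [|T T_node IH].
  (* For the leaf, the empty sequence is the only element. *)
  apply: trivial_closed_fixed_point => g; apply: aut_ext => x; apply: val_inj.
  have nil (y : L num tree_one) : val y = [::].
    case: y => -[|q r] //= yL; exfalso; move: yL.
    by rewrite in_L_cons // /is_head leqNgt (num_gt0 num_part).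
  by rewrite !nil.
apply: node_closed_fixed_point => //; first by move=> q; exact: IH.
case: T T_node {IH} => // T1 Ts _.
  (* At a sum each head is the integer naming its colour, so the chain is rigid. *)
  apply: trivial_closed_fixed_point => g; apply: aut_ext => x; apply: val_inj.
  have valE (y : {q : rat | is_head num (tree_sum T1 Ts) q}) : val y = (num (val y))%:R%R.
    by have /andP[_ /eqP] := valP y.
  by rewrite valE chain_aut_num -valE.
(* At a shuffle, being a head depends only on the colour. *)
apply: chain_closed_fixed_point => // q q' qq'.
by rewrite /is_head qq'.
Qed.
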